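(* Let $q>3$ be a prime power. Let $P=\{\varepsilon_1,\dots,\varepsilon_m\}$ be a rooted tree poset (with root $\varepsilon_1$), and suppose its shrubbery consists of the shrubs $S_{m_1},\dots,S_{m_s}$ (so that $S_{m_l}$ has $m_l$ elements). Then the minimum distance of the toric code $\mathcal{C}_{\mathbf{O}_P}$ over $\mathbb{F}_q$ is \[ d(\mathcal{C}_{\mathbf{O}_P})=(q-1)^{\,m-\sum_{i=1}^s (m_i-1)}\,(q-2)^{\,\sum_{i=1}^s (m_i-1)}. \]
   Context: All posets are finite. An upper order ideal of a poset $P$ is a subset $I$ such that $y\in I$ and $y\le x$ imply $x\in I$. For a poset $P=\{\varepsilon_1,\dots,\varepsilon_m\}$, identify $\mathbb{Q}^m$ with coordinates indexed by the elements of $P$; for $W\subseteq P$ let $\rho(W)=\sum_{\varepsilon_i\in W}\varepsilon_i\in\mathbb{Q}^m$ (the $0/1$ indicator vector of $W$). The order polytope $\mathbf{O}_P$ is the convex hull of $\{\rho(W): W \text{ an upper order ideal of } P\}$; it is a full-dimensional lattice polytope in $\mathbb{Q}^m$. Toric codes: for a full-dimensional lattice polytope $\mathbf{P}\subset\mathbb{Q}^m$, let $L_{\mathbf{P}}$ be the $\mathbb{F}_q$-span of the Laurent monomials $x^u=x_1^{u_1}\cdots x_m^{u_m}$, $u\in\mathbf{P}\cap\mathbb{Z}^m$. The toric code $\mathcal{C}_{\mathbf{P}}$ is the image of the evaluation map $L_{\mathbf{P}}\to\mathbb{F}_q^{(q-1)^m}$, $f\mapsto (f(t))_{t\in(\mathbb{F}_q^*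 )^m}$. For $f\in L_{\mathbf{P}}$ let $Z(f)$ be the number of $t\in(\mathbb{F}_q^* )^m$ with $f(t)=0$. The minimum distance is $d(\mathcal{C}_{\mathbf{P}})=(q-1)^m-\max_{0\ne f\in L_{\mathbf{P}}}Z(f)$. A rooted tree poset is a poset whose Hasse diagram is a rooted tree whose root is the unique smallest element, and whose leaves are exactly the maximal elements. The $k$-th shrub $S_k$ is the poset $\{\varepsilon_1,\dots,\varepsilon_k\}$ with $\varepsilon_1<\varepsilon_j$ for $j=2,\dots,k$ and no other relations. In a rooted tree poset $P$, a (sub)shrub is a subposet isomorphic to some $S_k$ consisting of an element $x$ together with all elements covering $x$, all of which are leaves of $P$; every leaf of $P$ belongs to a unique such shrub, and the shrubbery of $P$ is the collection of subshrubs of $P$ that contain the leaves of $P$.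
   Formalization: Assumes m ≥ 2 (for m = 1 the formula gives q-1 but the distance is q-2), and takes a shrub to be an element x with all leaves covering x (at least one), non-leaf covers being left out, so that every leaf lies in exactly one shrub. *)

(* Defs.v *)
From HB Require Import structures.
From mathcomp Require Export all_boot all_order all_algebra all_fingroup.
From mathcomp Require Export finmap.
From mathcomp Require Export monalg.

Set Implicit Arguments.
Unset Strict Implicit.
Unset Printing Implicit Defensive.

Import Order.TTheory GRing.Theory Num.Theory.
Local Open Scope ring_scope.

Section ToricCodes.
Variables (F : finFieldType) (T : finType).

Definition conv_hull (V : {ffun T -> rat} -> Prop) (x : {ffun T -> rat}) : Prop :=
  exists (n : nat) (v : 'I_n -> {ffun T -> rat}) (w : 'I_n -> rat),
    [/\ forall i, V (v i), forall i, 0 <= w i, \sum_(i < n) w i = 1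
      & forall e, x e = \sum_(i < n) w i * v i e].

Definition lattice_point (u : {ffun T -> int}) : {ffun T -> rat} :=
  [ffun e => (u e)%:~R].

(* Laurent polynomials are finitely supported functions from exponents to
   coefficients, so "f != 0" is about f as a polynomial, not as a function on
   the torus. *)
Definition laurent : Type := {malg F[{ffun T -> int}]}.

Definition toric_space (A : {ffun T -> rat} -> Prop) (f : laurent) : Prop :=
  forall u : {ffun T -> int}, u \in msupp f -> A (lattice_point u).

Definition torus : finType := {ffun T -> {unit F}}.

(* The coordinates of F_q^((q-1)^m) are indexed by the points of the torus. *)
Definition toric_eval (f : laurent) : {ffun torus -> F} :=
  [ffun t : torus =>
     \sum_(u <- msupp f) f@_u * \prod_(e : T) (val (t e) : F) ^ (u e)].

Definition toric_zeros (f : laurent) : nat :=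
  #|[set t : torus | toric_eval f t == 0]|.

(* "The maximum of toric_zeros over the nonzero elements of toric_space A
   exists, and (q - 1)^m minus this maximum is dist".  Since
   toric_zeros f <= (q - 1)^m, the truncated subtraction is exact. *)
Definition toric_min_distance (A : {ffun T -> rat} -> Prop) (dist : nat) : Prop :=
  exists f : laurent,
    [/\ toric_space A f, f != 0,
        forall g : laurent,
          toric_space A g -> g != 0 -> (toric_zeros g <= toric_zeros f)%N
      & dist = ((#|F| - 1) ^ #|T| - toric_zeros f)%N].

End ToricCodes.

Section Posets.
Variables (disp : Order.disp_t) (P : finPOrderType disp).
Implicit Types (x y r : P) (W A : {set P}).

Definition upper_ideal W : Prop :=
  forall y x, y \in W -> (y <= x)%O -> x \in W.

Definition rho W : {ffun P -> rat} := [ffun e => (e \in W)%:R].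

Definition order_polytope : {ffun P -> rat} -> Prop :=
  conv_hull (fun v => exists2 W, upper_ideal W & v = rho W).

Definition covered_by x y : bool :=
  (x < y)%O && ~~ [exists z, (x < z)%O && (z < y)%O].

Definition hasse : rel P := [rel x y | covered_by x y || covered_by y x].

(* A tree is a connected graph without simple cycles of length at least 3; in
   a symmetric loopless relation, ucycle also accepts [::], and [:: x; y]
   for an edge xy. *)
Definition hasse_is_tree : Prop :=
  (forall x y, connect hasse x y) /\
  (forall c : seq P, ucycle hasse c -> (size c <= 2)%N).

(* When the Hasse diagram is rooted at the smallest element, the children of x
   are the elements covering x. *)
Definition leaf x : bool := ~~ [exists y, covered_by x y].

Definition maximal x : bool := ~~ [exists y, (x < y)%O].

Definition rooted_tree_poset r : Prop :=
  [/\ hasse_is_tree, forall x, (r <= x)%O & forall x, leaf x = maximal x].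

Definition shrub_le (k : nat) : rel 'I_k :=
  fun i j : 'I_k => (i == j) || (val i == 0%N).

(* The subposet A of P is isomorphic to S_k; f is injective by antisymmetry. *)
Definition iso_shrub (k : nat) A : Prop :=
  exists f : 'I_k -> P,
    A = [set f i | i : 'I_k] /\ forall i j, (f i <= f j)%O = shrub_le i j.

(* A is made of x and of all the leaves that cover x.  Elements covering x that
   are not leaves are simply left out: otherwise a leaf with a sibling that is
   not a leaf would lie in no shrub, whereas each leaf has to lie in exactly
   one.  For the same reason the one-element shrub S_1 is excluded: it would be
   a second shrub containing a given leaf. *)
Definition subshrub A : Prop :=
  exists (x : P) (k : nat),
    [/\ (1 < k)%N, iso_shrub k A & A = x |: [set y | covered_by x y & leaf y]].

Definition in_shrubbery A : Prop :=
  subshrub A /\ exists2 y, y \in A & leaf y.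

End Posets.

(* Main.v *)
(** The lattice points of the order polytope are the indicators of the upper
    ideals, so a codeword is a polynomial [f = \sum_W c_W x^W] over upper
    ideals [W].  The product of [x_l - 1] over the leaves [l] vanishes exactly
    when some [x_l = 1], which gives the claimed value since every leaf lies in
    exactly one shrub.  Conversely, let [B] and [D] be disjoint upper ideals and
    let all the [W] in the support of [f] satisfy [B <= W <= B \cup D]; by
    induction on [#|D|], [f] has at least [(q-2)^l (q-1)^(m-l)] nonzeros, [l]
    being the number of maximal elements of [D].  Take [x] minimal in [D] and
    write [f = g + x h].  If no specialisation [g + u h] is zero, apply the
    induction hypothesis to each of them with [(B, D \ x)].  Otherwise
    [f = (x - u0) h], and [h] is supported between [B \cup {y > x}] and the same
    set enlarged by [D \ {y >= x}]; in a forest the latter is again an upper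
    ideal, and it has fewer maximal elements. *)
Require Import Defs.
From mathcomp Require Import zify ring.

Set Implicit Arguments.
Unset Strict Implicit.
Unset Printing Implicit Defensive.

Import Order.TTheory GRing.Theory Num.Theory.

(** * Specialisation and counting of nonzeros for squarefree polynomials *)

Section MultilinearPolynomials.
Variables (F : finFieldType) (T : finType).
Implicit Types (c : {ffun {set T} -> F}) (t : torus F T) (x : T) (u : {unit F}).
Open Scope ring_scope.

Definition meval c t : F := \sum_W c W * \prod_(e in W) val (t e).

Definition nonzeros c : nat := #|[set t : torus F T | meval c t != 0]|.

Definition upd x u t : torus F T := [ffun e => if e == x then u else t e].

(** Substitution of [u] for the variable [x]; the result still counts as a polynomial in all
    variables, so [nonzeros] ranges over the full torus. *)
Definition mspec x u c : {ffun {set T} -> F} :=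
  [ffun W : {set T} => if x \in W then 0 else c W + val u * c (x |: W)].

Definition mderiv x c : {ffun {set T} -> F} :=
  [ffun W : {set T} => if x \in W then 0 else c (x |: W)].

Lemma meval_upd x u c t : meval c (upd x u t) = meval (mspec x u c) t.
Proof.
have prod_upd (W : {set T}) : x \notin W ->
    \prod_(e in W) val (upd x u t e) = \prod_(e in W) val (t e).
  move=> xW; apply: eq_bigr => e eW; rewrite ffunE; case: eqP => // ex.
  by rewrite -ex eW in xW.
rewrite /meval (bigID (fun W : {set T} => x \in W)) /=.
rewrite [RHS](bigID (fun W : {set T} => x \in W)) /=.
rewrite [X in _ = X + _]big1 ?add0r; last first.
  by move=> W xW; rewrite ffunE xW mul0r.
rewrite (reindex_onto (fun W : {set T} => x |: W) (fun W => W :\ x)); last first.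
  by move=> W xW; rewrite setD1K.
rewrite [X in X + _ = _](eq_bigl (fun W : {set T} => x \notin W)); last first.
  move=> W /=; rewrite setU11 /=; apply/eqP/idP => [<-|xW]; first by rewrite setD11.
  by rewrite setU1K.
rewrite -big_split; apply: eq_bigr => W xW /=.
rewrite big_setU1 //= prod_upd // [mspec _ _ _ _]ffunE (negbTE xW) ffunE eqxx /=; ring.
Qed.

(* Swapping the coordinate [t x] with [u] is an involution of the pairs [(u, t)]. *)
Lemma sum_card_upd x (A : {set torus F T}) :
  (\sum_u #|[set t | upd x u t \in A]| = #|{: {unit F}}| * #|A|)%N.
Proof.
pose sw (p : {unit F} * torus F T) := (p.2 x, upd x p.1 p.2).
have swK : involutive sw.
  move=> [u t]; rewrite /sw /= /upd !ffunE eqxx; congr pair.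
  by apply/ffunP => e; rewrite !ffunE; case: eqP => // ->.
transitivity (\sum_u \sum_t (upd x u t \in A : nat))%N.
  apply: eq_bigr => u _; rewrite -sum1dep_card big_mkcond.
  by apply: eq_bigr => t _; case: ifP.
rewrite pair_bigA (reindex_inj (inv_inj swK)) /=.
transitivity (\sum_(u : {unit F}) \sum_t (t \in A : nat))%N.
  rewrite pair_bigA /=; apply: eq_bigr => -[u t] _ /=.
  by congr (nat_of_bool (_ \in A)); have [_ ->] := swK (u, t).
rewrite sum_nat_const; congr (_ * _)%N.
by rewrite -sum1_card [RHS]big_mkcond; apply: eq_bigr => t _; case: ifP.
Qed.

(** Averaging over the value at [x]: a specialisation ignores that coordinate, so every nonzero of
    [c] is counted once per unit. *)
Lemma sum_nonzeros_mspec x c :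
  (\sum_u nonzeros (mspec x u c) = #|{: {unit F}}| * nonzeros c)%N.
Proof.
rewrite -(sum_card_upd x); apply: eq_bigr => u _; apply: eq_card => t.
by rewrite !inE meval_upd.
Qed.

(** From [g = - u0 h] one gets [g + u h = (u - u0) h], where [h] is [mderiv x c]. *)
Lemma mspec_root x u0 c : mspec x u0 c = 0 ->
  forall u, mspec x u c = [ffun W => (val u - val u0) * mderiv x c W].
Proof.
move=> c0 u; apply/ffunP => W; rewrite !ffunE.
have := congr1 (fun d : {ffun {set T} -> F} => d W) c0; rewrite !ffunE.
case: ifP => _ ; first by rewrite mulr0.
by move/eqP; rewrite addr_eq0 => /eqP ->; ring.
Qed.

Lemma nonzeros_scale (a : F) c : a != 0 ->
  nonzeros [ffun W => a * c W] = nonzeros c.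
Proof.
move=> a0; apply: eq_card => t; rewrite !inE /meval.
under eq_bigr do rewrite ffunE -mulrA.
by rewrite -mulr_sumr mulf_eq0 negb_or a0.
Qed.

Lemma mderiv_neq0 x u0 c : c != 0 -> mspec x u0 c = 0 -> mderiv x c != 0.
Proof.
move=> /eqP c_neq0 c0; apply/eqP => d0; apply: c_neq0.
have dE (W : {set T}) : x \notin W -> c (x |: W) = 0.
  move=> xW; have := congr1 (fun d : {ffun {set T} -> F} => d W) d0.
  by rewrite !ffunE (negbTE xW).
apply/ffunP => W; rewrite [RHS]ffunE; have [xW|xW] := boolP (x \in W).
  by rewrite -(setD1K xW) dE // setD11.
have := congr1 (fun d : {ffun {set T} -> F} => d W) c0.
by rewrite !ffunE (negbTE xW) dE // mulr0 addr0.
Qed.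

(** In the sum over all specialisations [u0] contributes nothing, and each other unit contributes a
    nonzero multiple of [mderiv x c]. *)
Lemma nonzeros_mspec_root x u0 c : mspec x u0 c = 0 ->
  (#|{: {unit F}}| * nonzeros c = #|{: {unit F}}|.-1 * nonzeros (mderiv x c))%N.
Proof.
move=> c0; rewrite -(sum_nonzeros_mspec x) (bigD1 u0) //= c0.
have -> : nonzeros 0 = 0%N.
  apply/eqP; rewrite cards_eq0; apply/eqP/setP => t; rewrite !inE /meval big1 ?eqxx //.
  by move=> W _; rewrite ffunE mul0r.
rewrite add0n (eq_bigr (fun _ => nonzeros (mderiv x c))) => [|u uu0].
  rewrite sum_nat_const; congr (_ * _)%N.
  by rewrite [in RHS](cardD1 u0) inE /=; apply: eq_card => u; rewrite !inE andbT.
by rewrite (mspec_root c0) nonzeros_scale // subr_eq0 (inj_eq val_inj).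
Qed.

(** Base case of the induction: a monomial has no zero on the torus. *)
Lemma nonzeros_monomial (B : {set T}) c : c != 0 ->
  (forall W, c W != 0 -> W = B) -> nonzeros c = (#|{: {unit F}}| ^ #|T|)%N.
Proof.
move=> c0 cB; rewrite -card_ffun -[RHS]cardsT; apply: eq_card => t; rewrite !inE.
have cW (W : {set T}) : W != B -> c W = 0.
  by move=> WB; apply/eqP/negP => /negP /cB; apply/eqP.
have cB0 : c B != 0.
  apply: contraNneq c0 => cB0; apply/eqP/ffunP => W; rewrite [RHS]ffunE.
  by have [-> //|] := eqVneq W B; apply: cW.
rewrite /meval (bigD1 B) //= [X in _ + X]big1 ?addr0 => [|W /cW ->]; last by rewrite mul0r.
rewrite mulf_neq0 //; apply/prodf_neq0 => e _; rewrite -unitfE; exact: (valP (t e)).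
Qed.

End MultilinearPolynomials.

(** * The lower bound on the number of nonzeros *)

Section UpperIdeals.
Variables (F : finFieldType) (disp : Order.disp_t) (P : finPOrderType disp).
Implicit Types (c : {ffun {set P} -> F}) (x y z w : P) (B D W : {set P}).
Open Scope ring_scope.

Definition maximals D : {set P} := [set x in D | maximal x].

Lemma maximal_above x : exists2 y, maximal y & (x <= y)%O.
Proof.
pose up y := #|[set z | (y < z)%O]|.
have [n] := ubnP (up x); elim: n x => // n IHn x; rewrite ltnS => upx.
have [mx|] := boolP (maximal x); first by exists x.
rewrite negbK => /existsP [y xy].
have [|z mz yz] := IHn y; last by exists z => //; exact/ltW/(lt_le_trans xy).
apply: leq_trans upx; apply: proper_card; apply/properP; split.
  by apply/subsetP => z; rewrite !inE; apply: lt_trans.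
by exists y; rewrite !inE ?ltxx.
Qed.

Lemma minimal_in D : D != set0 ->
  exists2 x, x \in D & forall y, y \in D -> (y <= x)%O -> y = x.
Proof.
case/set0Pn => x0; pose dn y := #|[set z in D | (z < y)%O]|.
have [n] := ubnP (dn x0); elim: n x0 => // n IHn x; rewrite ltnS => dnx xD.
have [/exists_inP [y yD yx]|] := boolP [exists y in D, (y < x)%O]; last first.
  move=> /exists_inPn xmin; exists x => // y yD.
  by rewrite le_eqVlt (negbTE (xmin y yD)) orbF => /eqP.
apply: (IHn y) => //; apply: leq_trans dnx.
apply/proper_card/properP; split.
  by apply/subsetP => z; rewrite !inE => /andP [->] /lt_trans /(_ yx) ->.
by exists y; rewrite !inE ?yD ?ltxx.
Qed.

Definition ideal_between B D c : Prop :=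
  forall W, c W != 0 -> [/\ upper_ideal W, B \subset W & W \subset B :|: D].

Lemma mspec_supp x (u : {unit F}) c W : mspec x u c W != 0 ->
  x \notin W /\ (c W != 0 \/ c (x |: W) != 0).
Proof.
rewrite ffunE; case: ifP => [|_]; first by rewrite eqxx.
have [->|] := eqVneq (c W) 0; last by split=> //; left.
by rewrite add0r mulf_eq0 negb_or => /andP [_]; split=> //; right.
Qed.

Lemma mderiv_supp x c W : mderiv x c W != 0 -> x \notin W /\ c (x |: W) != 0.
Proof. by rewrite ffunE; case: ifP; rewrite ?eqxx. Qed.

Section MinimalElement.
Variables (B D : {set P}) (x : P).
Hypotheses (upB : upper_ideal B) (disBD : [disjoint B & D]) (xD : x \in D).
Hypothesis (xmin : forall y, y \in D -> (y <= x)%O -> y = x).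

Let xB : x \notin B. Proof. by rewrite (disjointFl disBD). Qed.

Lemma minimal_union y : y \in B :|: D -> (y <= x)%O -> y = x.
Proof.
rewrite inE => /orP [yB yx|]; last exact: xmin.
by have := upB yB yx; rewrite (negbTE xB).
Qed.

Lemma upper_ideal_setD1 W :
  W \subset B :|: D -> upper_ideal W -> upper_ideal (W :\ x).
Proof.
move=> /subsetP sW upW y z; rewrite !inE => /andP [yx yW] yz.
rewrite (upW y z) // andbT; apply: contraNneq yx => zx.
by apply/eqP/minimal_union; [exact: sW | rewrite -zx].
Qed.

(** Whichever of [W] and [x |: W] carries a nonzero coefficient of [c], [W] is an upper ideal with
    the minimal element [x] removed. *)
Lemma ideal_between_mspec (u : {unit F}) c :
  ideal_between B D c -> ideal_between B (D :\ x) (mspec x u c).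
Proof.
move=> cBD W /mspec_supp [xW cW].
have [V [upV BV VD] WV] : exists2 V : {set P},
    [/\ upper_ideal V, B \subset V & V \subset B :|: D] & W = V :\ x.
  case: cW => /cBD VP; [exists W => // | exists (x |: W) => //].
    by apply/setP => y; rewrite !inE; case: eqP => // ->; rewrite (negbTE xW).
  by rewrite setU1K.
split; first by rewrite WV; apply: upper_ideal_setD1.
  by rewrite WV subsetD1 BV xB.
rewrite WV; apply/subsetP => y; rewrite !inE => /andP [-> /(subsetP VD)].
by rewrite inE.
Qed.

(** A set [W] in the support comes from the upper ideal [x |: W], which contains everything above
    [x]; hence the larger lower bound. *)
Lemma ideal_between_mderiv c : ideal_between B D c ->
  ideal_between (B :|: [set y | (x < y)%O]) (D :\: [set y | (x <= y)%O])
    (mderiv x c).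
Proof.
move=> cBD W /mderiv_supp [xW /cBD [upV BV VD]].
split; first by rewrite -(setU1K xW); apply: upper_ideal_setD1.
  apply/subsetP => y; rewrite !inE => /orP [yB|xy].
    have := subsetP BV y yB; rewrite !inE => /orP [/eqP yx|//].
    by rewrite yx (negbTE xB) in yB.
  have := upV x y (setU11 _ _) (ltW xy); rewrite !inE => /orP [/eqP yx|//].
  by rewrite yx ltxx in xy.
apply/subsetP => y yW; have := subsetP VD y; rewrite !inE yW orbT => /(_ isT).
case/orP => [->//|->]; rewrite andbT lt_def.
have -> : y != x by apply: contraNneq xW => <-.
by case: (x <= y)%O; rewrite ?orbT.
Qed.

End MinimalElement.

Lemma card_maximals_setD1 D x :
  (#|maximals (D :\ x)| <= #|maximals D|)%N.
Proof.
by apply/subset_leq_card/subsetP => y; rewrite !inE => /andP [/andP [_ ->]].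
Qed.

Lemma card_maximals_setDup D x : upper_ideal D -> x \in D ->
  (#|maximals (D :\: [set y | (x <= y)%O])| < #|maximals D|)%N.
Proof.
move=> upD xD; have [y my xy] := maximal_above x.
apply/proper_card/properP; split.
  by apply/subsetP => z; rewrite !inE => /andP [/andP [_ ->]].
by exists y; rewrite !inE ?xy ?(upD _ _ xD xy) ?my.
Qed.

(** Each further maximal element trades a factor [a] for [a.-1]. *)
Lemma bound_antitone (a m k l : nat) : (k <= l)%N -> (l <= m)%N ->
  (a.-1 ^ l * a ^ (m - l) <= a.-1 ^ k * a ^ (m - k))%N.
Proof.
move=> kl lm; have -> : (m - k = (l - k) + (m - l))%N by lia.
rewrite -{1}(subnKC kl) !expnD mulnA leq_mul2r leq_mul2l; apply/orP; right.
by case: (l - k)%N => [|j]; rewrite ?expn0 ?leqnn ?leq_exp2r ?leq_pred ?orbT.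
Qed.

Hypothesis forest : forall x y w : P, (x <= w)%O -> (y <= w)%O -> (x >=< y)%O.

Lemma nonzeros_ge B D c :
  upper_ideal B -> upper_ideal D -> [disjoint B & D] ->
  ideal_between B D c -> c != 0 ->
  (#|{: {unit F}}|.-1 ^ #|maximals D| * #|{: {unit F}}| ^ (#|P| - #|maximals D|)
     <= nonzeros c)%N.
Proof.
set a := #|{: {unit F}}|.
have a_gt0 : (0 < a)%N by apply/card_gt0P; exists 1%g.
have [n] := ubnP #|D|; elim: n B D c => // n IHn B D c; rewrite ltnS => Dn.
move=> upB upD disBD cBD c0.
have [D0|] := eqVneq D set0.
  have -> : #|maximals D| = 0%N.
    by rewrite D0; apply: eq_card0 => y; rewrite !inE.
  rewrite (@nonzeros_monomial _ _ B) ?subn0 ?mul1n // => W /cBD [_ BW].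
  by rewrite D0 setU0 => WB; apply/eqP; rewrite eqEsubset BW WB.
move=> /minimal_in [x xD xmin].
have leP D' : (#|maximals D'| <= #|P|)%N by apply: max_card.
have xB : x \notin B by rewrite (disjointFl disBD).
have [/existsP [u0 /eqP cu0]|] := boolP [exists u, mspec x u c == 0].
  rewrite -(leq_pmul2l a_gt0) (nonzeros_mspec_root cu0).
  set B' := B :|: [set y | (x < y)%O]; set D' := D :\: [set y | (x <= y)%O].
  have lD := card_maximals_setDup upD xD; rewrite -/D' in lD.
  have IH : (a.-1 ^ #|maximals D'| * a ^ (#|P| - #|maximals D'|)
               <= nonzeros (mderiv x c))%N.
    apply: (IHn B').
    - apply: leq_trans Dn; apply/proper_card/properP; split; first exact: subsetDl.
      by exists x => //; rewrite !inE lexx.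
    - move=> y z; rewrite !inE => /orP [yB yz|xy yz]; first by rewrite (upB y).
      by rewrite (lt_le_trans xy) ?orbT.
    - move=> y z; rewrite !inE => /andP [xy yD] yz; rewrite (upD y z) // andbT.
      (* The forest hypothesis enters here: [x] and [y] lie below [z], so they are comparable, and
         [y <= x] gives [y = x] by minimality. *)
      apply: contra xy => xz; have := forest xz yz; rewrite /Order.comparable.
      by case/orP => // yx; rewrite (xmin y yD yx).
    - rewrite -setI_eq0; apply/eqP/setP => y; rewrite !inE.
      case: (boolP (y \in B)) => [yB|_] /=.
        by rewrite (disjointFr disBD yB) andbF.
      by case: (boolP (x < y)%O) => //= /ltW ->.
    - exact: ideal_between_mderiv.
    - exact: mderiv_neq0 cu0.
  apply: leq_trans (leq_mul (leqnn a.-1) IH).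
  (* The loss of a maximal element pays for the factor [a.-1]: the bound is compared at
     [#|maximals D'|.+1], which is at most [#|P|]. *)
  apply: leq_trans (leq_mul (leqnn a) (bound_antitone a lD (leP D))) _.
  rewrite expnS; have -> : (#|P| - #|maximals D'| = (#|P| - #|maximals D'|.+1).+1)%N.
    by have := leP D; lia.
  by rewrite expnS; apply/eq_leq; ring.
(* No specialisation vanishes, so each satisfies the bound, and so does their average. *)
move=> /existsPn cu; rewrite -(leq_pmul2l a_gt0) -(sum_nonzeros_mspec x).
rewrite -sum_nat_const; apply: leq_sum => u _.
have lD := card_maximals_setD1 D x.
apply: leq_trans (bound_antitone a lD (leP D)) _.
apply: (IHn B) => //.
- by apply: leq_trans Dn; apply/proper_card/properD1.
- apply: (@upper_ideal_setD1 B D x) => //; exact: subsetUr.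
- by rewrite (disjointWr _ disBD) // subsetDl.
- exact: ideal_between_mspec.
Qed.
End UpperIdeals.

(** * Rooted trees: comparability below an element, and counting leaves by shrubs *)

Section RootedTrees.
Variables (disp : Order.disp_t) (P : finPOrderType disp).
Implicit Types (x y z w a b : P) (A : {set P}).

(** Among the elements [y] with [x <= y < w], one with the largest down-set is covered by [w]. *)
Lemma lower_cover x w : (x < w)%O -> exists2 b, (x <= b)%O & covered_by b w.
Proof.
move=> xw; pose p := [pred y | (x <= y)%O && (y < w)%O].
have px : p x by rewrite /= lexx.
case: (arg_maxnP (fun y => #|[set z | (z <= y)%O]|) px) => b /andP [xb bw] bmax.
exists b => //; rewrite /covered_by bw; apply/existsP => -[z /andP [bz zw]].
have := bmax z; rewrite inE zw (le_trans xb (ltW bz)) => /(_ isT).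
rewrite /= leqNgt => /negP []; apply/proper_card/properP; split.
  by apply/subsetP => y; rewrite !inE => /le_trans -> //; apply: ltW.
by exists z; rewrite !inE ?lexx // lt_geF.
Qed.

Lemma hasse_sym : symmetric (@hasse disp P).
Proof. by move=> x y; rewrite /hasse /= orbC. Qed.

Lemma cover_hasse x y : covered_by x y -> hasse x y.
Proof. by move=> xy; apply/orP; left. Qed.

Variable r : P.
Hypothesis treeP : rooted_tree_poset r.

Let below w : rel P := [rel x y | [&& hasse x y, (x < w)%O & (y < w)%O]].

(** Descent along lower covers leads from [a] to the root and stays below [w], so the path avoids
    [w]. *)
Lemma connect_below w a : (a < w)%O -> connect (below w) r a.
Proof.
have [_ r_le _] := treeP.
have [n] := ubnP #|[set z | (z < a)%O]|; elim: n a => // n IHn a; rewrite ltnS => an aw.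
have [-> //|ra] := eqVneq a r.
have [|b _ ba] := @lower_cover r a; first by rewrite lt_def ra r_le.
have ba' : (b < a)%O by case/andP: ba.
have bw := lt_trans ba' aw.
apply: (@connect_trans _ _ b); last by apply: connect1; apply/and3P; split=> //; apply: cover_hasse.
apply: IHn bw; apply: leq_trans an; apply/proper_card/properP; split.
  by apply/subsetP => z; rewrite !inE => /lt_trans; apply.
by exists b; rewrite !inE ?ltxx.
Qed.

(* Two lower covers of [w] would be joined by a path of elements below [w],
   which [w] closes into a simple cycle. *)
Lemma lower_cover_unique a b w : covered_by a w -> covered_by b w -> a = b.
Proof.
have [[_ acyclic] _ _] := treeP.
move=> aw bw; apply/eqP; apply: contraT => ab.
have aw' : (a < w)%O by case/andP: aw.
have bw' : (b < w)%O by case/andP: bw.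
have below_sym : connect_sym (below w).
  by apply: sym_connect_sym => x y; apply/and3P/and3P => -[xy lx ly]; split=> //; rewrite hasse_sym.
have : connect (below w) a b.
  by apply: connect_trans (connect_below bw'); rewrite below_sym; apply: connect_below.
case/connectP => p0 p0path /esym p0last.
case/shortenP: p0path p0last => p ppath puniq _ plast.
have lt_p : all (fun z => (z < w)%O) p.
  elim: (p) (a) ppath => //= z s IHs y /andP [/and3P [_ _ ->]]; exact: IHs.
have hpath : path (@hasse disp P) a p.
  by apply: sub_path ppath => y z /and3P [].
have wnot : w \notin a :: p.
  rewrite inE negb_or; apply/andP; split; first by rewrite gt_eqF.
  by apply/negP => /(allP lt_p); rewrite ltxx.
have /acyclic : ucycle (@hasse disp P) (w :: a :: p).
  apply/andP; split; last by rewrite cons_uniq wnot.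
  change (path (@hasse disp P) w (rcons (a :: p) w)); rewrite rcons_path.
  apply/andP; split; last by rewrite /= plast; apply: cover_hasse.
  by apply/andP; split=> //; rewrite hasse_sym; apply: cover_hasse.
(* A cycle of size at most 2 leaves room only for [w] and [a], so [p] is empty and [a = b]. *)
by case: (p) plast => //= abE; rewrite abE eqxx in ab.
Qed.

(** Elements strictly below [w] lie below its unique lower cover, so induction passes from [w] to
    that cover. *)
Lemma tree_comparable x y w : (x <= w)%O -> (y <= w)%O -> (x >=< y)%O.
Proof.
have [n] := ubnP #|[set z | (z < w)%O]|; elim: n w => // n IHn w; rewrite ltnS => wn.
rewrite le_eqVlt => /predU1P [-> yw|xw]; first by rewrite /Order.comparable yw orbT.
rewrite le_eqVlt => /predU1P [->|yw]; first by rewrite /Order.comparable ltW.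
have [b xb bw] := lower_cover xw; have [b' yb bw'] := lower_cover yw.
rewrite -(lower_cover_unique bw bw') in yb; apply: (IHn b) => //.
apply: leq_trans wn; apply/proper_card/properP.
have b_lt : (b < w)%O by case/andP: bw.
split; last by exists b; rewrite !inE ?ltxx.
by apply/subsetP => z; rewrite !inE => /lt_trans; apply.
Qed.

Definition shrub x : {set P} := x |: [set y | covered_by x y & leaf y].

Lemma iso_shrub_card k A : iso_shrub k A -> #|A| = k.
Proof.
case=> f [-> fle]; rewrite card_imset ?card_ord // => i j fij.
have := fle i j; have := fle j i; rewrite fij lexx => /esym ji /esym ij.
case/orP: ij => [/eqP //|/eqP i0]; case/orP: ji => [/eqP //|/eqP j0].
by apply: val_inj; rewrite /= i0 j0.
Qed.

Lemma leafN x y : covered_by x y -> ~~ leaf x.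
Proof. by move=> xy; rewrite negbK; apply/existsP; exists y. Qed.

Lemma iso_shrub_shrub x : iso_shrub #|shrub x| (shrub x).
Proof.
pose L := [set y | covered_by x y & leaf y].
have xL : x \notin L by rewrite !inE /covered_by ltxx.
have -> : #|shrub x| = #|L|.+1 by rewrite cardsU1 xL.
 (* Listing [x] first gives it index 0, the minimum for [shrub_le]. *)
 pose f (i : 'I_#|L|.+1) := nth x (x :: enum L) i.
have sizeE : size (x :: enum L) = #|L|.+1 by rewrite /= -cardE.
have fL (i : 'I_#|L|.+1) : (0 < i)%N -> f i \in L.
  case: i => [[|i] ltiL] // _; rewrite -(mem_enum (mem L)) /f /=.
  by apply: mem_nth; rewrite -ltnS (leq_trans ltiL) // -sizeE.
have f0 (i : 'I_#|L|.+1) : val i = 0%N -> f i = x by rewrite /f /= => ->.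
have uniqL : uniq (x :: enum L) by rewrite /= mem_enum xL enum_uniq.
have f_inj : injective f.
  by move=> i j /eqP; rewrite nth_uniq ?sizeE ?ltn_ord // => /eqP/val_inj.
exists f; split.
  apply/setP => y; apply/idP/imsetP => [yS|[i _ ->]].
    have yE : y \in x :: enum L by rewrite inE mem_enum -in_setU1.
    have ltyL : index y (x :: enum L) < #|L|.+1 by rewrite -sizeE index_mem.
    by exists (Ordinal ltyL) => //; rewrite /f nth_index.
  by have [/f0 ->|/fL fiL] := posnP i; [exact: setU11 | apply/setU1P; right].
move=> i j; rewrite /shrub_le; have [i0|i0] := posnP i.
  rewrite (f0 i i0) orbT; have [/f0 ->|/fL] := posnP j; first exact: lexx.
  by rewrite !inE => /andP [/andP [/ltW]].
rewrite orbF -(inj_eq f_inj).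
rewrite le_eqVlt; case: eqP => //= _.
(* For a positive index [f i] is a leaf, hence maximal, and is strictly below nothing. *)
have := fL i i0; rewrite inE => /andP [_]; have [_ _ ->] := treeP.
by move/existsPn => /(_ (f j)) /negbTE.
Qed.

Hypothesis P_gt1 : 1 < #|P|.

(** In a one-element poset the root would be a leaf lying in no shrub, and counting leaves by shrubs
    would fail. *)
Lemma root_not_leaf : ~~ leaf r.
Proof.
have [_ r_le ->] := treeP; rewrite negbK.
have [y yr] : exists y, y != r.
  have := cardC1 r; case: (pickP (predC1 r)) => [y yr _|/eq_card0 ->]; first by exists y.
  by move=> P1; move: P_gt1; rewrite -subn_gt0 subn1 -P1.
by apply/existsP; exists y; rewrite lt_def yr r_le.
Qed.

Lemma in_shrubberyP A :
  in_shrubbery A <-> exists2 x, [exists y, covered_by x y && leaf y] & A = shrub x.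
Proof.
split=> [[[x [k [k1 kA AE]]] _]|[x /existsP [y /andP [xy ly]] ->]].
  exists x => //; rewrite -(iso_shrub_card kA) AE cardsU1 in k1.
  have /card_gt0P [y] : 0 < #|[set y | covered_by x y & leaf y]|.
    by rewrite -ltnS (leq_trans k1) // -add1n leq_add2r leq_b1.
  by rewrite inE => yP; apply/existsP; exists y.
have yS : y \in shrub x by rewrite !inE xy ly orbT.
split; last by exists y.
exists x, #|shrub x|; split=> //; last exact: iso_shrub_shrub.
rewrite (cardsD1 x) setU11 ltnS; apply/card_gt0P; exists y; rewrite inE yS andbT inE.
by apply: contraTneq xy => ->; rewrite /covered_by ltxx.
Qed.

(** Double counting of pairs of a shrub and a leaf in it: all elements of a shrub but its root are
    leaves, and a leaf lies only in the shrub rooted at its unique lower cover. *)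
Lemma sum_shrubs (s : nat) (S : 'I_s -> {set P}) (ms : 'I_s -> nat) :
  injective S -> (forall A, in_shrubbery A <-> exists i, A = S i) ->
  (forall i, iso_shrub (ms i) (S i)) ->
  \sum_(i < s) (ms i - 1) = #|[set x : P | maximal x]|.
Proof.
move=> S_inj SP msP; have [_ r_le leafE] := treeP.
have S_shrub i : exists x, S i = shrub x /\ ~~ leaf x.
  have /in_shrubberyP [x /existsP [y /andP [xy _]] Sx] : in_shrubbery (S i) by apply/SP; exists i.
  by exists x; rewrite (leafN xy).
have card_S i : ms i - 1 = \sum_(y | leaf y) (y \in S i).
  have [x [Sx xl]] := S_shrub i; rewrite -(iso_shrub_card (msP i)) Sx.
  rewrite cardsU1 inE /covered_by ltxx /= add1n subn1 /= -sum1_card big_mkcond [RHS]big_mkcond.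
  apply: eq_bigr => y _; rewrite !inE; case: (boolP (leaf y)) => ly; rewrite ?andbF //= andbT.
  by have [yx|_] := eqVneq y x; [rewrite -yx ly in xl | case: ifP].
rewrite (eq_bigr _ (fun i _ => card_S i)) exchange_big -sum1_card.
rewrite [RHS](eq_bigl (fun y => leaf y)) => [|y]; last by rewrite inE leafE.
apply: eq_bigr => y ly.
have yr : y != r by apply: contraTneq ly => ->; apply: root_not_leaf.
have [|x _ xy] := @lower_cover r y; first by rewrite lt_def yr r_le.
have [i0 Si0] : exists i, shrub x = S i.
  by apply/SP/in_shrubberyP; exists x => //; apply/existsP; exists y; rewrite xy.
rewrite (bigD1 i0) //= -Si0 !inE xy ly orbT big1 // => i ii0.
apply/eqP; rewrite eqb0; apply: contraNN ii0 => yS; apply/eqP/S_inj.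
have [z [Sz zl]] := S_shrub i; rewrite -Si0 Sz; congr shrub.
move: yS; rewrite Sz !inE => /orP [/eqP yz|/andP [zy _]]; first by rewrite -yz ly in zl.
exact: lower_cover_unique zy xy.
Qed.
End RootedTrees.

(** * Lattice points of the order polytope, and an extremal codeword *)

Section OrderPolytope.
Variables (F : finFieldType) (disp : Order.disp_t) (P : finPOrderType disp).
Implicit Types (W : {set P}) (f : laurent F P) (c : {ffun {set P} -> F}).
Open Scope ring_scope.

Definition exponent W : {ffun P -> int} := [ffun e => (e \in W)%:R].

Lemma exponent_inj : injective exponent.
Proof.
move=> V W /ffunP VW; apply/setP => e; have := VW e; rewrite !ffunE.
by case: (e \in V); case: (e \in W).
Qed.

Lemma order_polytope_exponent W :
  upper_ideal W -> order_polytope (lattice_point (exponent W)).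
Proof.
move=> upW; exists 1%N, (fun _ => rho W), (fun _ => 1).
split=> // [i||e]; first by exists W.
  by rewrite big_ord1.
by rewrite big_ord1 mul1r !ffunE; case: (e \in W).
Qed.

(** Lying in [[0, 1]] and being monotone pass from the generators to convex combinations; an
    integral point is then the indicator of an upper ideal. *)
Lemma lattice_point_order_polytope (u : {ffun P -> int}) :
  order_polytope (lattice_point u) -> exists2 W, upper_ideal W & u = exponent W.
Proof.
case=> n [v [w [vP w0 w1 uE]]].
have v01 i e : 0 <= v i e <= 1.
  by have [W _ ->] := vP i; rewrite ffunE; case: (e \in W).
have vmono i e e' : (e <= e')%O -> v i e <= v i e'.
  have [W upW -> ee'] := vP i; rewrite !ffunE.
  by case: (boolP (e \in W)) => [/upW /(_ ee') -> //|_]; case: (e' \in W).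
have u0 e : 0 <= u e.
  rewrite -(ler0z rat); have := uE e; rewrite ffunE => ->.
  by apply: sumr_ge0 => i _; apply: mulr_ge0 => //; case/andP: (v01 i e).
have u1 e : u e <= 1.
  rewrite -(ler_int rat); have := uE e; rewrite ffunE => ->; rewrite -w1.
  by apply: ler_sum => i _; apply: ler_piMr => //; case/andP: (v01 i e).
have umono e e' : (e <= e')%O -> u e <= u e'.
  move=> ee'; rewrite -(ler_int rat).
  have := uE e; rewrite ffunE => ->; have := uE e'; rewrite ffunE => ->.
  by apply: ler_sum => i _; apply: ler_wpM2l => //; apply: vmono.
exists [set e | u e == 1].
  move=> y x; rewrite !inE => /eqP uy yx; rewrite eq_le u1 -uy; exact: umono.
apply/ffunP => e; rewrite ffunE inE; move: (u0 e) (u1 e).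
by case: (u e) => [[|[|k]]|k].
Qed.

Definition mcoefs f : {ffun {set P} -> F} := [ffun W => f@_(exponent W)].

Lemma toric_eval_mcoefs f t :
  toric_space (@order_polytope disp P) f -> toric_eval f t = meval (mcoefs f) t.
Proof.
move=> fP; rewrite ffunE /meval.
pose s := [seq exponent W | W : {set P}].
transitivity (\sum_(u <- s) f@_u * \prod_(e : P) (val (t e) : F) ^ (u e)).
  (* Exponents in [s] outside the support have coefficient zero; once they are discarded, [s] is a
     permutation of the support. *)
  rewrite -(@big_rmcond_in _ _ _ _ s (fun u => u \in msupp f)) => [|u _ uf]; last first.
    by rewrite mcoeff_outdom ?mul0r.
  rewrite -[RHS]big_filter; apply/perm_big/uniq_perm => [||u].
  - exact: fset_uniq.
  - by rewrite filter_uniq // map_inj_uniq ?enum_uniq //; apply: exponent_inj.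
  rewrite mem_filter; case: (boolP (u \in msupp f)) => //= uf.
  have [W _ ->] := lattice_point_order_polytope (fP u uf).
  by rewrite image_f.
rewrite big_image /=; apply: eq_bigr => W _; rewrite ffunE; congr (_ * _).
rewrite [RHS]big_mkcond; apply: eq_bigr => e _; rewrite ffunE; case: (e \in W) => //=.
Qed.

(** Every exponent of [f] is the indicator of a set, so [mcoefs] loses no coefficient. *)
Lemma mcoefs_neq0 f :
  toric_space (@order_polytope disp P) f -> f != 0 -> mcoefs f != 0.
Proof.
move=> fP; apply: contraNneq => f0; apply/eqP/malgP => u; rewrite mcoeff0.
case: (boolP (u \in msupp f)) => [uf|/mcoeff_outdom //].
have [W _ ->] := lattice_point_order_polytope (fP u uf).
by have := congr1 (fun c : {ffun {set P} -> F} => c W) f0; rewrite !ffunE.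
Qed.

Lemma mcoefs_ideal f : toric_space (@order_polytope disp P) f ->
  ideal_between set0 setT (mcoefs f).
Proof.
move=> fP W; rewrite ffunE mcoeff_neq0 => /fP /lattice_point_order_polytope [V upV].
by move/exponent_inj => ->; rewrite sub0set setUT subsetT.
Qed.

Lemma toric_zeros_mcoefs f : toric_space (@order_polytope disp P) f ->
  (toric_zeros f + nonzeros (mcoefs f) = (#|F| - 1) ^ #|P|)%N.
Proof.
move=> fP; rewrite subn1 -card_finField_unit cardsT -card_ffun -[RHS]cardsT.
rewrite -(cardsID [set t | toric_eval f t == 0] [set: torus F P]) setTI; congr (_ + _)%N.
by apply: eq_card => t; rewrite !inE andbT -toric_eval_mcoefs.
Qed.

Definition laurent_of c : laurent F P := \sum_W << c W *g exponent W >>.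

Lemma laurent_ofK c : mcoefs (laurent_of c) = c.
Proof.
apply/ffunP => W; rewrite ffunE raddf_sum (bigD1 W) //= mcoeffUU.
rewrite big1 ?addr0 // => V VW; rewrite mcoeffU (inj_eq exponent_inj).
by rewrite (negbTE VW).
Qed.

Lemma laurent_of_space c : (forall W, c W != 0 -> upper_ideal W) ->
  toric_space (@order_polytope disp P) (laurent_of c).
Proof.
move=> cP u; rewrite -mcoeff_neq0 raddf_sum => uc.
have [/existsP [W /andP [cW /eqP uW]]|/existsPn no] :=
  boolP [exists W, (c W != 0) && (u == exponent W)].
  by rewrite uW; apply/order_polytope_exponent/cP.
rewrite big1 ?eqxx // in uc => W _; rewrite /= mcoeffU; have := no W.
by rewrite negb_and negbK (eq_sym u) => /orP [/eqP ->|/negbTE ->]; rewrite ?mul0rn.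
Qed.

(* The coefficients of [\prod_(x maximal) (X_x - 1)]. *)
Definition extremal : {ffun {set P} -> F} :=
  [ffun W : {set P} => \prod_(x : P)
    (if x \in W then (maximal x)%:R else if maximal x then -1 else 1)].

(** Only sets of maximal elements have a nonzero coefficient, and nothing lies strictly above their
    elements. *)
Lemma extremal_upper W : extremal W != 0 -> upper_ideal W.
Proof.
rewrite ffunE => /prodf_neq0 W0 y x yW yx.
have := W0 y isT; rewrite yW; case: (boolP (maximal y)); rewrite ?eqxx // => my _.
move: yx; rewrite le_eqVlt => /predU1P [<- //|yx].
by case/negP: my; apply/existsP; exists x.
Qed.

Lemma meval_extremal t :
  meval extremal t = \prod_(x : P) (if maximal x then val (t x) - 1 else 1).
Proof.
pose G (x : P) : F := if maximal x then -1 else 1.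
(* Each factor becomes a sum of two terms, so that [bigA_distr] expands the product over subsets
   [W]. *)
rewrite (eq_bigr (fun x => (maximal x)%:R * val (t x) + G x)) => [|x _]; last first.
  by rewrite /G; case: (maximal x); rewrite ?mul1r ?mul0r ?add0r.
rewrite bigA_distr /=; apply: eq_bigr => W _; rewrite ffunE.
rewrite [X in _ * X]big_mkcond -big_split; apply: eq_bigr => x _ /=.
by case: (x \in W); rewrite ?mulr1.
Qed.

Lemma extremal_neq0 : extremal != 0.
Proof.
apply/eqP => /ffunP /(_ set0); rewrite !ffunE; apply/eqP/prodf_neq0 => x _.
by rewrite inE; case: ifP; rewrite ?oppr_eq0 oner_eq0.
Qed.

(** The nonzeros form a product set: coordinates at maximal elements avoid [1], the others are
    free. *)
Lemma nonzeros_extremal :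
  nonzeros extremal = (#|{: {unit F}}|.-1 ^ #|[set x : P | maximal x]|
    * #|{: {unit F}}| ^ (#|P| - #|[set x : P | maximal x]|))%N.
Proof.
pose A (x : P) := [pred u : {unit F} | maximal x ==> (u != 1%g)].
have -> : nonzeros extremal = #|family A|.
  apply: eq_card => t; rewrite inE meval_extremal; apply/prodf_neq0/familyP => tA x.
    have := tA x isT; rewrite !inE; case: (maximal x) => //=.
    by rewrite subr_eq0; apply: contraNneq => ->.
  move=> _; have := tA x; rewrite !inE; case: (maximal x) => /= [|_]; last by rewrite oner_eq0.
  by rewrite subr_eq0; apply: contraNneq => tx; apply/eqP/val_inj.
rewrite card_family foldrE big_map big_enum /=.
rewrite (bigID (fun x : P => maximal x)) /=; congr (_ * _)%N.
  rewrite (eq_bigr (fun=> #|{: {unit F}}|.-1)) => [|x mx].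
    by rewrite prod_nat_const; congr (_ ^ _)%N; apply: eq_card => x; rewrite !inE.
  by rewrite [in RHS](cardD1 1%g) inE /=; apply: eq_card => u; rewrite !inE mx andbT.
rewrite (eq_bigr (fun=> #|{: {unit F}}|)) => [|x mx].
  rewrite prod_nat_const -(cardsC [set x : P | maximal x]) addKn; congr (_ ^ _)%N.
  by apply: eq_card => x; rewrite !inE.
by apply: eq_card => u; rewrite !inE (negbTE mx).
Qed.

End OrderPolytope.

(** * The minimum distance *)

Theorem theorem4p4
  (q : nat) (F : finFieldType) (hF : #|F| = q) (hq : 3 < q)
  (disp : Order.disp_t) (P : finPOrderType disp)
  (m : nat) (hm : #|P| = m) (hm2 : 1 < m)
  (r : P) (hP : rooted_tree_poset r)
  (s : nat) (S : 'I_s -> {set P}) (S_inj : injective S)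
  (hS : forall A : {set P}, in_shrubbery A <-> exists i : 'I_s, A = S i)
  (ms : 'I_s -> nat) (hms : forall i : 'I_s, iso_shrub (ms i) (S i)) :
  toric_min_distance F (@order_polytope disp P)
    ((q - 1) ^ (m - \sum_(i < s) (ms i - 1))
     * (q - 2) ^ (\sum_(i < s) (ms i - 1))).
Proof.
have unitE : #|{: {unit F}}| = q - 1.
  by rewrite -cardsT card_finField_unit hF subn1.
have P_gt1 : 1 < #|P| by rewrite hm.
have q2 : q - 2 = (q - 1).-1 by rewrite -subn1 -subnDA.
(* The claimed distance becomes the number of nonzeros of [extremal]. *)
rewrite (sum_shrubs hP P_gt1 S_inj hS hms) q2 -unitE -hm mulnC -nonzeros_extremal.
have fP := laurent_of_space (@extremal_upper F disp P).
have fE := laurent_ofK (extremal F P).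
have zf := toric_zeros_mcoefs fP; rewrite fE in zf.
exists (laurent_of (extremal F P)); split=> //; last by rewrite -zf addKn.
  apply: contraNneq (extremal_neq0 F P) => f0; rewrite -fE f0.
  by apply/eqP/ffunP => W; rewrite !ffunE mcoeff0.
move=> g gP g0; have zg := toric_zeros_mcoefs gP.
(* Zeros and nonzeros add up to the size of the torus, so bounding the zeros of [g] above means
   bounding its nonzeros below. *)
rewrite -(leq_add2r (nonzeros (extremal F P))) zf -zg leq_add2l nonzeros_extremal.
have maxE : maximals [set: P] = [set x | maximal x].
  by apply/setP => x; rewrite !inE.
(* The bound is used with [B] empty and [D] all of [P], which admits every upper ideal. *)
rewrite -maxE; apply: (@nonzeros_ge _ _ _ _ set0).
- exact: tree_comparable hP.
- by move=> y x; rewrite inE.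
- by move=> y x _ _; rewrite inE.
- by rewrite -setI_eq0 set0I.
- exact: mcoefs_ideal.
- exact: mcoefs_neq0.
Qed.
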